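(* Let $1<a\le b$ be integers, let $p=(c,d)\in D_{a,b}$ and $I=(x^a,y^b,u_p)$. For all integers $i\ge1$ write $$ic=r_ia+c_i,\qquad id=s_ib+d_i,$$ with integers $r_i,s_i,c_i,d_i$ such that $0\le c_i<a$ and $0\le d_i<b$, and set $p_i=(c_i,d_i)$. Let $k$ be the smallest integer $\geq 1$ such that $r_k+s_k\ge k$. Then $L=(x^a,y^b,u_{p_1},\ldots,u_{p_{k-1}})$ is the unique smallest monomial ideal in $\mathcal I_{a,b}$ containing $I$ with $r(L)=1$; that is, $L\in\mathcal I_{a,b}$, $I\subseteq L$, $r(L)=1$, and $L\subseteq L'$ for every $L'\in\mathcal I_{a,b}$ with $I\subseteq L'$ and $r(L')=1$.
   Context: $K$ is a field. For $q=(e,f)$ with $e,f$ nonnegative integers, $u_q=x^ey^f\in K[x,y]$. $D_{a,b}=\{(i,j)\in\mathbb Z^2 : bi+aj\ge ab,\ i<a,\ j<b\}$. For a monomial ideal $I\subset K[x,y]$, $G(I)$ is its unique minimal set of monomial generators. $\mathcal I_{a,b}$ is the set of monomial ideals $I\subset K[x,y]$ with $x^a,y^b\in G(I)$ and $be+af\ge ab$ for all $x^ey^f\in G(I)$. For $I\in\mathcal I_{a,b}$ and $J=(x^a,y^b)$, the reduction number $r(I)$ is the smallest integer $r\ge0$ with $I^{r+1}=JI^r$ (such $r$ exists). *)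

(* Defs.v *)
From mathcomp Require Import all_boot all_order all_algebra.
From mathcomp Require Import boolp classical_sets.
From mathcomp Require Import mpoly.
From mathcomp Require Import zify.

Set Implicit Arguments.
Unset Strict Implicit.
Unset Printing Implicit Defensive.

Import Order.TTheory GRing.Theory Num.Theory.

Local Open Scope classical_set_scope.
Local Open Scope ring_scope.

Section Ideals.
Variable R : comNzRingType.
Implicit Types (I J S : set R) (n : nat).

(* Prop-valued, and the unit ideal is allowed (unlike in [idealr_closed]):
   the zeroth power of an ideal is the whole ring. *)
Definition is_ideal I : Prop :=
  [/\ I 0, forall f g, I f -> I g -> I (f + g)
         & forall h f, I f -> I (h * f)].

Definition ideal_gen S : set R := smallest is_ideal S.

Definition ideal_mul I J : set R :=
  ideal_gen [set h | exists f g, [/\ I f, J g & h = f * g]].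

Definition ideal_pow I n : set R := iter n (ideal_mul I) setT.

(* [n] is the reduction number of [I] with respect to [J]. *)
Definition is_reduction_number J I n : Prop :=
  ideal_pow I n.+1 = ideal_mul J (ideal_pow I n) /\
  forall m, ideal_pow I m.+1 = ideal_mul J (ideal_pow I m) -> (n <= m)%N.

End Ideals.

(* The bivariate polynomial ring K[x,y] is {mpoly K[2]}, where x is the variable
   of index 0 and y the variable of index 1. *)
Section MonomialIdeals.
Variable K : fieldType.
Implicit Types (I G : set {mpoly K[2]}) (a b e f n : nat).

Definition xy_mon e f : {mpoly K[2]} := 'X_ord0 ^+ e * 'X_ord_max ^+ f.

(* The monomial u_q of a lattice point q; it is only meaningful (and only used)
   when both coordinates of q are nonnegative. *)
Definition u_mon (q : int * int) : {mpoly K[2]} := xy_mon `|q.1|%N `|q.2|%N.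

Definition monomials : set {mpoly K[2]} := [set m | exists e f, m = xy_mon e f].

Definition monomial_ideal I : Prop :=
  exists2 G, G `<=` monomials & I = ideal_gen G.

(* [G] is G(I). *)
Definition min_mon_gens I G : Prop :=
  [/\ G `<=` monomials, I = ideal_gen G
    & forall H, H `<=` monomials -> I = ideal_gen H -> H `<=` G -> H = G].

(* The set of ideals I_{a,b}. *)
Definition ideals_ab a b : set (set {mpoly K[2]}) :=
  [set I | monomial_ideal I /\
     exists G, [/\ min_mon_gens I G, G (xy_mon a 0), G (xy_mon 0 b)
       & forall e f, G (xy_mon e f) -> (a * b <= b * e + a * f)%N]].

Definition J_ab a b : set {mpoly K[2]} :=
  ideal_gen [set xy_mon a 0; xy_mon 0 b].

Definition is_red_ab a b I n : Prop := is_reduction_number (J_ab a b) I n.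

End MonomialIdeals.

Arguments xy_mon : clear implicits.
Arguments u_mon : clear implicits.
Arguments ideals_ab : clear implicits.

Definition D_ab (a b : nat) : set (int * int) :=
  [set q | [/\ a%:Z * b%:Z <= b%:Z * q.1 + a%:Z * q.2, q.1 < a%:Z & q.2 < b%:Z]].

Definition smallest_index (P : nat -> Prop) (k : nat) : Prop :=
  [/\ (1 <= k)%N, P k & forall j, (1 <= j)%N -> P j -> (k <= j)%N].

Lemma D_ab_gt0 (a b : nat) (q : int * int) :
  (0 < a)%N -> (0 < b)%N -> D_ab a b q -> 0 < q.1 /\ 0 < q.2.
Proof.
case: q => i j a0 b0 [/= H ia jb].
have Hj : a%:Z * j < a%:Z * b%:Z by rewrite ltr_pM2l.
have Hi : b%:Z * i < b%:Z * a%:Z by rewrite ltr_pM2l.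
have pi : 0 < b%:Z * i by lia.
have pj : 0 < a%:Z * j by lia.
by split; [rewrite pmulr_rgt0 in pi | rewrite pmulr_rgt0 in pj].
Qed.

(* The inequality holds at k = ab, so the set minimised over is nonempty. *)
Lemma smallest_index_exists (a b : nat) (c d : int) (r s ci di : nat -> int) :
    (1 < a)%N -> (a <= b)%N -> D_ab a b (c, d) ->
    (forall i : nat, (1 <= i)%N ->
       [/\ i%:Z * c = r i * a%:Z + ci i, i%:Z * d = s i * b%:Z + di i,
           0 <= ci i < a%:Z & 0 <= di i < b%:Z]) ->
  exists k, smallest_index (fun k => k%:Z <= r k + s k) k.
Proof.
move=> a1 ab [/= cd _ _] div; pose P (k : nat) := (1 <= k)%N && (k%:Z <= r k + s k).
have exP : exists k, P k.
  exists (a * b)%N; rewrite /P; have ab1 : (1 <= a * b)%N by nia.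
  rewrite ab1 /=; have [] := div _ ab1; rewrite PoszM.
  move: (r _) (s _) (ci _) (di _) => r0 s0 c0 d0 Ec Ed Hc Hd.
  have rE : r0 = b%:Z * c by nia.
  have sE : s0 = a%:Z * d by nia.
  by rewrite rE sE.
exists (ex_minn exP); case: ex_minnP => k /andP[k1 Pk] kmin.
by split=> // j j1 Pj; apply: kmin; rewrite /P j1.
Qed.

(* Main.v *)
Require Import Defs.
From mathcomp Require Import all_boot all_order all_algebra.
From mathcomp Require Import boolp classical_sets.
From mathcomp Require Import mpoly.
From mathcomp Require Import zify ring.

(** Everything is decided on exponents, since a monomial lies in an ideal
    generated by monomials exactly when one of these divides it.  Weigh the
    lattice point [(e, f)] by [b e + a f], so that the generators of an ideal of
    [ideals_ab] have weight at least [ab].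

    Since [p] has weight at least [ab] and [p_i] has weight less than [2ab],
    subtracting [(r_i a, s_i b)] from [i p] shows that [r_i + s_i >= i - 1]
    for every [i >= 1]; as [k] is the first index with [r_k + s_k >= k],
    equality holds for [i < k] ([carry_lt_k]).  Two things follow.

    - Each [p_i] with [i < k] has weight at least [ab], so that [L] is in
      [ideals_ab].
    - The vectors [p_i + p_j - q], for suitable points [q], have the form
      [(A a, B b)], and [A + B] is an alternating sum of values of [r + s],
      which the equality makes at least 1.  Both coordinates of [p_i + p_j] are
      too small for [A] or [B] to exceed 1, so both are 0 or 1, and at least one
      of them is 1.

    With [q = p_(i+j)] when [i + j < k] and [q = p_k + p_t], [t = i + j - k],
    when [i + j > k], this shows that [u_(p_i) u_(p_j)] is in [J L]
    ([residue_sum]); when [i + j = k] the choice [q = p_k] even gives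
    [A = B = 1], and the product is divisible by [x^a y^b].
    Hence [L^2 = J L], and [L <> J] because it contains [u_p].

    Conversely let [L'] contain [u_p] and satisfy [L'^2 = J L'].  If [u_(p_i)] is
    in [L'] and [i + 1 < k], then [p_i + p] exceeds [p_(i+1)] by exactly [(a, 0)]
    or [(0, b)] ([residue_succ]), while [u_(p_i) u_p] is [x^a] or [y^b] times an
    element of [L'].  It has to be the same power in both, because the
    coordinates of [p_(i+1)] are less than [a] and [b]; hence [u_(p_(i+1))]
    is in [L'], and induction on [i] gives [L] inside [L']. *)

Set Implicit Arguments.
Unset Strict Implicit.
Unset Printing Implicit Defensive.

Import Order.TTheory GRing.Theory Num.Theory.

Local Open Scope classical_set_scope.
Local Open Scope ring_scope.

(** * Products of ideals given by generators *)

Section IdealProducts.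
Variable R : comNzRingType.
Implicit Types (A B I S X : set R).

Lemma ideal_gen_is_ideal S : is_ideal (ideal_gen S).
Proof.
split=> [I [[]] //|f g Sf Sg I [II SI]|h f Sf I [II SI]]; case: (II) => _ ID IM.
- by apply: ID; [apply: Sf|apply: Sg].
- by apply: IM; apply: Sf.
Qed.

(** The colon ideal [(I : X)]; it lets a statement about products be checked on
    generators, one factor at a time. *)
Lemma is_ideal_colon I X : is_ideal I -> is_ideal [set f | forall g, X g -> I (f * g)].
Proof.
move=> [I0 ID IM]; split=> [g _|f f' If If' g Xg|h f If g Xg].
- by rewrite mul0r.
- by rewrite mulrDl; apply: ID; [apply: If|apply: If'].
- by rewrite -mulrA; apply/IM/If.
Qed.

Lemma ideal_mul_gen A B :
  ideal_mul (ideal_gen A) (ideal_gen B) = ideal_gen [set f * g | f in A & g in B].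
Proof.
apply/seteqP; split; apply: smallest_sub (ideal_gen_is_ideal _) _.
  set P := ideal_gen [set _ | _ in _ & _ in _] => _ [f [g [Af Bg ->]]].
  have PI : is_ideal P := ideal_gen_is_ideal _.
  suff sub : ideal_gen A `<=` [set f | forall g, ideal_gen B g -> P (f * g)].
    by exact: (sub _ Af _ Bg).
  apply: smallest_sub (is_ideal_colon _ PI) _ => {Af Bg}f Af {}g.
  suff sub : ideal_gen B `<=` [set g | forall f, A f -> P (g * f)].
    by rewrite mulrC => Bg; exact: (sub _ Bg _ Af).
  apply: smallest_sub (is_ideal_colon _ PI) _ => {}g Bg {Af}f Af.
  by apply: sub_gen_smallest; exists f => //; exists g => //; rewrite mulrC.
move=> _ [f Af [g Bg <-]]; apply: sub_gen_smallest.
by exists f, g; split=> //; apply: sub_gen_smallest.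
Qed.

Lemma ideal_mulT I : is_ideal I -> ideal_mul I setT = I.
Proof.
move=> II; apply/seteqP; split.
  by apply: smallest_sub => // _ [f [g [If _ ->]]]; rewrite mulrC; case: II => _ _; apply.
by move=> f If; apply: sub_gen_smallest; exists f, 1; split=> //; rewrite mulr1.
Qed.

End IdealProducts.

(** * Ideals generated by monomials *)

Section Monomials.
Variable K : fieldType.
Implicit Types (G S T : set {mpoly K[2]}) (e f : nat).

Local Notation mon := (xy_mon K).

(** The exponents of a monomial can be read off its support, which turns
    questions on [xy_mon] into questions on pairs of naturals. *)
Lemma xy_mon_msupp e f : exists m : 'X_{1..2},
  [/\ msupp (mon e f) = [:: m], m ord0 = e & m ord_max = f].
Proof.
exists (U_(ord0) *+ e + U_(ord_max) *+ f)%MM.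
rewrite /xy_mon !mpolyXn -mpolyXD msuppX !mnmDE !mulmnE !mnm1E /=.
by split; rewrite ?mul1n ?mul0n ?addn0.
Qed.

Lemma xy_mon_inj e f e' f' : mon e f = mon e' f' -> e = e' /\ f = f'.
Proof.
move=> E; have [m [Em <- <-]] := xy_mon_msupp e f.
by have [m' [+ <- <-]] := xy_mon_msupp e' f'; rewrite -E Em => -[->].
Qed.

Lemma xy_monM e f e' f' : mon e f * mon e' f' = mon (e + e') (f + f').
Proof. by rewrite /xy_mon mulrACA -!exprD. Qed.

Lemma ideal_xy_mon_le I e f e' f' :
  is_ideal I -> I (mon e f) -> (e <= e')%N -> (f <= f')%N -> I (mon e' f').
Proof.
move=> [_ _ IM] Ief ee ff; have -> : mon e' f' = mon (e' - e) (f' - f) * mon e f.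
  by rewrite xy_monM !subnK.
exact: IM.
Qed.

(** The polynomials all of whose terms are divisible by an element of [G] form an
    ideal, and this ideal contains [G]. *)
Lemma monomial_dvd_gen G e f : G `<=` @monomials K -> ideal_gen G (mon e f) ->
  exists e' f', [/\ G (mon e' f'), (e' <= e)%N & (f' <= f)%N].
Proof.
move=> GM; pose P (m : 'X_{1..2}) :=
  exists e' f', [/\ G (mon e' f'), (e' <= m ord0)%N & (f' <= m ord_max)%N].
have sub : ideal_gen G `<=` [set p | forall m, m \in msupp p -> P m].
  apply: smallest_sub.
    split=> [m|p q Pp Pq m|h p Pp m]; first by rewrite msupp0.
      by move/msuppD_le; rewrite mem_cat => /orP[/Pp|/Pq].
    move/msuppM_le/allpairsP => [[m1 m2] /= [_ /Pp [e' [f' [Gm le0 le1]]] ->]].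
    by exists e', f'; rewrite !mnmDE; split=> //; apply: leq_trans (leq_addl _ _).
  move=> g Gg m; have [e' [f' Eg]] := GM _ Gg; move: Gg; rewrite Eg => Gg.
  have [m' [-> E0 E1]] := xy_mon_msupp e' f'; rewrite inE => /eqP->.
  by exists e', f'; rewrite E0 E1.
move=> /sub Pef; have [m [Em <- <-]] := xy_mon_msupp e f.
by apply: Pef; rewrite Em inE.
Qed.

Definition minimal_monomials S : set {mpoly K[2]} :=
  [set m | exists e f, [/\ m = mon e f, S m &
    forall e' f', S (mon e' f') -> (e' <= e)%N -> (f' <= f)%N -> e' = e /\ f' = f]].

(** Divisibility of monomials is well founded, as it lowers the total degree. *)
Lemma minimal_monomial_below S e f : S (mon e f) ->
  exists e' f', [/\ minimal_monomials S (mon e' f'), (e' <= e)%N & (f' <= f)%N].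
Proof.
have [n] := ubnP (e + f); elim: n e f => // n IH e f len Sef.
have [min|] := pselect (forall e' f', S (mon e' f') ->
  (e' <= e)%N -> (f' <= f)%N -> e' = e /\ f' = f).
  by exists e, f; split=> //; exists e, f.
move=> /existsNP[e' /existsNP[f' /not_implyP[Sef' /not_implyP[ee /not_implyP[ff ne]]]]].
have [|e2 [f2 [min le1 le2]]] := IH e' f' _ Sef'.
  by have [E|?] := eqVneq (e' + f')%N (e + f)%N; [case: ne|]; lia.
by exists e2, f2; split=> //; lia.
Qed.

(** A generating set [H] made of minimal monomials contains all of them: an
    element of [H] that divides a minimal monomial is equal to it. *)
Lemma min_mon_gens_minimal S : S `<=` @monomials K ->
  min_mon_gens (ideal_gen S) (minimal_monomials S).
Proof.
move=> SM; have mS : minimal_monomials S `<=` S by move=> m [e [f []]].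
split=> [|| H HM EH Hmin]; first exact: subset_trans SM.
  apply/seteqP; split; apply: smallest_sub (ideal_gen_is_ideal _) _.
    move=> m Sm; have [e [f Em]] := SM _ Sm; move: Sm; rewrite Em => Sm.
    have [e' [f' [min ee ff]]] := minimal_monomial_below Sm.
    by apply: ideal_xy_mon_le ee ff; [apply: ideal_gen_is_ideal|apply: sub_gen_smallest].
  by apply: subset_trans (@sub_gen_smallest _ _ _).
apply/seteqP; split=> // _ [e [f [-> Sef min]]].
have : ideal_gen H (mon e f) by rewrite -EH; apply: sub_gen_smallest.
move=> /(monomial_dvd_gen HM)[e' [f' [Hef ee ff]]].
by have [<- <-] := min e' f' (mS _ (Hmin _ Hef)) ee ff.
Qed.

(** A generator that divides [x^a] is a power of [x], and the bound on its weight
    leaves only [x^a] itself; so [x^a], and likewise [y^b], is minimal. *)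
Lemma ideals_ab_gen a b S : (0 < a)%N -> (0 < b)%N -> S `<=` @monomials K ->
  S (mon a 0) -> S (mon 0 b) ->
  (forall e f, S (mon e f) -> (a * b <= b * e + a * f)%N) ->
  ideals_ab K a b (ideal_gen S).
Proof.
move=> a0 b0 SM Sa Sb wS; split; first by exists S.
exists (minimal_monomials S); split.
- exact: min_mon_gens_minimal.
- exists a, 0%N; split=> // e f /wS w ea f0.
  by have -> : f = 0%N; [lia | split=> //; nia].
- exists 0%N, b; split=> // e f /wS w e0 fb.
  by have -> : e = 0%N; [lia | split=> //; nia].
- by move=> e f [e' [f' [_ Sef _]]]; apply: wS.
Qed.

Lemma monomial_J_mul_gen a b G e f : G `<=` @monomials K ->
  ideal_mul (@J_ab K a b) (ideal_gen G) (mon e f) ->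
  exists e' f', G (mon e' f') /\
    ((a + e' <= e)%N /\ (f' <= f)%N \/ (e' <= e)%N /\ (b + f' <= f)%N).
Proof.
move=> GM; rewrite ideal_mul_gen => /monomial_dvd_gen[].
  move=> _ [t + [g /GM[e' [f' ->]] <-]].
  by case=> ->; rewrite xy_monM; do 2!eexists.
move=> e1 [f1 [[t Tt [g Gg Etg]] e1e f1f]]; have [e' [f' Eg]] := GM _ Gg.
rewrite Eg in Gg Etg; case: Tt Etg => ->; rewrite xy_monM => /xy_mon_inj[E1 E2].
  by exists e', f'; split=> //; left; lia.
by exists e', f'; split=> //; right; lia.
Qed.

(** [L^2 = J L] is checked on products of two generators; the reduction number is
    not 0 as soon as some generator is divisible neither by [x^a] nor by [y^b],
    since [L = J] would force such a divisor. *)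
Lemma is_red_ab_1_gen a b S : S (mon a 0) -> S (mon 0 b) ->
  (exists e f, [/\ S (mon e f), (e < a)%N & (f < b)%N]) ->
  S `<=` @monomials K ->
  (forall e f e' f', S (mon e f) -> S (mon e' f') ->
     ideal_mul (@J_ab K a b) (ideal_gen S) (mon (e + e') (f + f'))) ->
  is_red_ab a b (ideal_gen S) 1.
Proof.
move=> Sa Sb [e [f [Sef ea fb]]] SM HS.
have TS : [set mon a 0; mon 0 b] `<=` S by move=> _ [->|->].
rewrite /is_red_ab /is_reduction_number.
have E1 : ideal_pow (ideal_gen S) 1 = ideal_gen S.
  by apply: ideal_mulT; apply: ideal_gen_is_ideal.
split=> [|[|//]].
  rewrite [ideal_pow _ 2](_ : _ = ideal_mul (ideal_gen S) (ideal_pow (ideal_gen S) 1)) // E1.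
  apply/seteqP; split.
    rewrite ideal_mul_gen; apply: smallest_sub; first exact: ideal_gen_is_ideal.
    move=> _ [m Sm [m' Sm' <-]].
    have [[e1 [f1 E]] [e2 [f2 E']]] := (SM _ Sm, SM _ Sm').
    by rewrite E E' in Sm Sm' *; rewrite xy_monM; apply: HS.
  rewrite !ideal_mul_gen; apply: smallest_sub; first exact: ideal_gen_is_ideal.
  move=> _ [t Tt [m Sm <-]]; apply: sub_gen_smallest.
  by exists t; [apply: TS|exists m].
rewrite E1 /= ideal_mulT; last exact: ideal_gen_is_ideal.
move=> EJ; have : ideal_gen S (mon e f) by apply: sub_gen_smallest.
rewrite EJ => /monomial_dvd_gen[_ [->|->]|e' [f' [[]]]]; try by do 2!eexists.
  by move=> /xy_mon_inj[-> _]; lia.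
by move=> /xy_mon_inj[_ ->]; lia.
Qed.

End Monomials.

(** * Carries in the division of the multiples of p *)

Section Carries.
Variables (a b : nat) (c d : int) (r s ci di : nat -> int) (k : nat).
Hypotheses (a_gt1 : (1 < a)%N) (le_ab : (a <= b)%N) (Dcd : D_ab a b (c, d)).
Hypothesis division : forall i : nat, (1 <= i)%N ->
  [/\ i%:Z * c = r i * a%:Z + ci i, i%:Z * d = s i * b%:Z + di i,
      0 <= ci i < a%:Z & 0 <= di i < b%:Z].
Hypothesis kmin : smallest_index (fun j => j%:Z <= r j + s j) k.

(** The point [p_i] is [i p] minus [(r_i a, s_i b)], and each of the [r_i + s_i]
    subtracted units costs exactly [ab] in weight. *)
Lemma weight_residue i : (1 <= i)%N ->
  (i%:Z - (r i + s i)) * (a%:Z * b%:Z) <= b%:Z * ci i + a%:Z * di i.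
Proof.
move=> i1; have [Ec Ed _ _] := division i1; have [/= w _ _] := Dcd.
have : i%:Z * (a%:Z * b%:Z) <= i%:Z * (b%:Z * c + a%:Z * d) by apply: ler_wpM2l.
have -> : i%:Z * (b%:Z * c + a%:Z * d) = b%:Z * (i%:Z * c) + a%:Z * (i%:Z * d) by ring.
by rewrite Ec Ed; lia.
Qed.

(** The weight of [p_i] is less than [2ab], which bounds the carries from below. *)
Lemma index_le_carry i : (1 <= i)%N -> i%:Z <= r i + s i + 1.
Proof.
move=> i1; have w := weight_residue i1; have [_ _ /andP[_ Hc] /andP[_ Hd]] := division i1.
have : (i%:Z - (r i + s i)) * (a%:Z * b%:Z) < 2 * (a%:Z * b%:Z).
  apply: le_lt_trans w _; nia.
by rewrite ltr_pM2r ?mulr_gt0; lia.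
Qed.

Lemma carry_lt_k i : (1 <= i < k)%N -> r i + s i = i%:Z - 1.
Proof.
move=> /andP[i1 ik]; have [_ _ kle] := kmin; have := index_le_carry i1.
by case: (lerP i%:Z (r i + s i)) => [/(kle _ i1)|]; lia.
Qed.

Lemma weight_ge i : (1 <= i < k)%N -> a%:Z * b%:Z <= b%:Z * ci i + a%:Z * di i.
Proof.
move=> ik; have := weight_residue (i := i); rewrite carry_lt_k //.
by move=> /(_ ltac:(lia)); lia.
Qed.

Lemma division1 : [/\ ci 1%N = c, di 1%N = d, r 1%N = 0 & s 1%N = 0].
Proof.
have [/= _ ca db] := Dcd.
have [/= c0 d0] := D_ab_gt0 (ltnW a_gt1) (leq_trans (ltnW a_gt1) le_ab) Dcd.
have [] := division (leqnn 1); rewrite !mul1r => Ec Ed Hc Hd.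
have r0 : r 1%N = 0 by nia.
have s0 : s 1%N = 0 by nia.
by move: Ec Ed; rewrite r0 s0 !mul0r !add0r.
Qed.

Lemma k_gt1 : (1 < k)%N.
Proof.
have [k1 Pk _] := kmin; rewrite ltn_neqAle k1 andbT; apply/eqP => k_eq.
by move: Pk; rewrite -k_eq; have [_ _ -> ->] := division1.
Qed.

Lemma residue_add i j : (1 <= i)%N -> (1 <= j)%N ->
  ci i + ci j = (r (i + j)%N - r i - r j) * a%:Z + ci (i + j)%N /\
  di i + di j = (s (i + j)%N - s i - s j) * b%:Z + di (i + j)%N.
Proof.
move=> i1 j1; have [Eci Edi _ _] := division i1; have [Ecj Edj _ _] := division j1.
have [Ec Ed _ _] := division (leq_trans i1 (leq_addr j i)).
by move: Ec Ed; rewrite PoszD !mulrDl; lia.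
Qed.

(** A sum of two residues is less than twice the modulus, so that no carry
    exceeds 1; a positive total then leaves no room for a negative carry. *)
Lemma carry_bounds (A B x y u v : int) :
  x = A * a%:Z + u -> y = B * b%:Z + v -> x < 2 * a%:Z -> y < 2 * b%:Z ->
  0 <= u -> 0 <= v -> 1 <= A + B -> 0 <= A <= 1 /\ 0 <= B <= 1.
Proof.
move=> Ex Ey xa yb u0 v0 AB.
have A1 : A <= 1 by nia.
have B1 : B <= 1 by nia.
by lia.
Qed.

Lemma carry_cases (A B x y u v : int) :
  x = A * a%:Z + u -> y = B * b%:Z + v -> x < 2 * a%:Z -> y < 2 * b%:Z ->
  0 <= u -> 0 <= v -> 1 <= A + B ->
  (a%:Z + u <= x /\ v <= y) \/ (u <= x /\ b%:Z + v <= y).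
Proof.
move=> Ex Ey xa yb u0 v0 AB; have [HA HB] := carry_bounds Ex Ey xa yb u0 v0 AB.
have [EA|EA] : A = 1 \/ A = 0 by lia.
  by left; nia.
by right; nia.
Qed.

(** Divisibility of [u_(p_i) u_(p_j)] by a generator of [J L]: the first
    alternative means divisibility by [x^a y^b], a product of [x^a] in [J] and
    [y^b] in [L]. *)
Lemma residue_sum i j : (1 <= i < k)%N -> (1 <= j < k)%N ->
  (a%:Z <= ci i + ci j /\ b%:Z <= di i + di j) \/
  exists2 t, (1 <= t < k)%N &
    (a%:Z + ci t <= ci i + ci j /\ di t <= di i + di j) \/
    (ci t <= ci i + ci j /\ b%:Z + di t <= di i + di j).
Proof.
move=> ik jk; have sum_i := carry_lt_k ik; have sum_j := carry_lt_k jk.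
have [[i1 _] [j1 _]] := (andP ik, andP jk); have [k1 Pk _] := kmin.
have [_ _ Hci Hdi] := division i1; have [_ _ Hcj Hdj] := division j1.
have [_ _ Hck Hdk] := division k1.
have x_lt : ci i + ci j < 2 * a%:Z by lia.
have y_lt : di i + di j < 2 * b%:Z by lia.
have [Ec Ed] := residue_add i1 j1.
have ij1 : (1 <= i + j)%N := leq_trans i1 (leq_addr j i).
have [_ _ Hcij Hdij] := division ij1; have le_ij := index_le_carry ij1.
set x := ci i + ci j in Ec x_lt *; set y := di i + di j in Ed y_lt *.
have [lt_ij|gt_ij|E_ij] := ltngtP (i + j) k.
(* Here r + s at i + j is i + j - 1, so the total carry is exactly 1. *)
- right; exists (i + j)%N; rewrite ?ij1 //.
  by apply: carry_cases Ec Ed x_lt y_lt _ _ _; lia.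
(* Comparing with p_k + p_t instead, the total carry is at least
   k + (t - 1) - (i - 1) - (j - 1) = 1. *)
- set t := (i + j - k)%N; have t1 : (1 <= t)%N by rewrite subn_gt0.
  have tk : (1 <= t < k)%N by rewrite t1; lia.
  right; exists t => //; have sum_t := carry_lt_k tk.
  have [Eck Edk] := residue_add k1 t1; rewrite (subnKC (ltnW gt_ij)) in Eck Edk.
  have Ex : x = (r k + r t - r i - r j) * a%:Z + (ci k + ci t) by lia.
  have Ey : y = (s k + s t - s i - s j) * b%:Z + (di k + di t) by lia.
  have [_ _ Hct Hdt] := division t1.
  by have := carry_cases Ex Ey x_lt y_lt; lia.
(* The residue p_k need not be in L, but the total carry is now at least
   k - (i - 1) - (j - 1) = 2. *)
- left; rewrite E_ij in Ec Ed.
  have [||| HA HB] := carry_bounds Ec Ed x_lt y_lt; try lia.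
  set A := (_ - _) in Ec HA; set B := (_ - _) in Ed HB.
  have [EA EB] : A = 1 /\ B = 1 by lia.
  by rewrite EA EB in Ec Ed; lia.
Qed.

(** Below [k] the sum [r + s] grows by exactly 1 at each step, so exactly one
    coordinate carries. *)
Lemma residue_succ i : (1 <= i)%N -> (i.+1 < k)%N ->
  (ci i + c = ci i.+1 + a%:Z /\ di i + d = di i.+1) \/
  (ci i + c = ci i.+1 /\ di i + d = di i.+1 + b%:Z).
Proof.
move=> i1 ik; have [c1 d1 r1 s1] := division1.
have [_ _ Hci Hdi] := division i1; have [_ _ Hc1 Hd1] := division (leqnn 1).
have [_ _ Hcs Hds] := division (ltn0Sn i).
have [Ec Ed] := residue_add i1 (leqnn 1); rewrite addn1 in Ec Ed.
have sum_i := carry_lt_k (i := i) ltac:(lia); have sum_s := carry_lt_k (i := i.+1) ltac:(lia).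
have [||||| HA HB] := carry_bounds Ec Ed; try lia.
set A := (_ - _) in Ec HA; set B := (_ - _) in Ed HB.
rewrite -c1 -d1; have [[EA EB]|[EA EB]] : (A = 1 /\ B = 0) \/ (A = 0 /\ B = 1) by lia.
  by left; lia.
by right; lia.
Qed.

End Carries.

(** * The smallest ideal of reduction number one *)

Theorem theorem6p4 (K : fieldType) (a b : nat) (c d : int)
    (r s ci di : nat -> int) (k : nat) :
    (1 < a)%N -> (a <= b)%N -> D_ab a b (c, d) ->
    (forall i : nat, (1 <= i)%N ->
       [/\ i%:Z * c = r i * a%:Z + ci i, i%:Z * d = s i * b%:Z + di i,
           0 <= ci i < a%:Z & 0 <= di i < b%:Z]) ->
    smallest_index (fun j => j%:Z <= r j + s j) k ->
  let I := ideal_gen [set xy_mon K a 0; xy_mon K 0 b; u_mon K (c, d)] in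
  let L := ideal_gen ([set xy_mon K a 0; xy_mon K 0 b] `|`
             [set u_mon K (ci i, di i) | i in [set i | (1 <= i < k)%N]]) in
  [/\ ideals_ab K a b L, I `<=` L, is_red_ab a b L 1
    & forall L' : set {mpoly K[2]},
        ideals_ab K a b L' -> I `<=` L' -> is_red_ab a b L' 1 -> L `<=` L'].
Proof.
move=> a1 le_ab Dcd division kmin I L.
have k1 := k_gt1 a1 le_ab Dcd division kmin.
have [c1 d1 _ _] := division1 a1 le_ab Dcd division.
have [a_gt0 b_gt0] : (0 < a)%N /\ (0 < b)%N by lia.
have [/= c0 d0] := D_ab_gt0 a_gt0 b_gt0 Dcd; have [/= _ ca db] := Dcd.
pose S := [set xy_mon K a 0; xy_mon K 0 b] `|`
  [set u_mon K (ci i, di i) | i in [set i | (1 <= i < k)%N]].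
rewrite -/S in L *.
have SM : S `<=` @monomials K by move=> _ [[]->|[i _ <-]]; do 2!eexists.
have Sa : S (xy_mon K a 0) by left; left.
have Sb : S (xy_mon K 0 b) by left; right.
have Su i : (1 <= i < k)%N -> S (u_mon K (ci i, di i)) by move=> ik; right; exists i.
have Scase e f : S (xy_mon K e f) ->
  [\/ e = a /\ f = 0%N, e = 0%N /\ f = b
    | exists2 i, (1 <= i < k)%N & e%:Z = ci i /\ f%:Z = di i].
  case=> [[]/xy_mon_inj|[i /= ik /xy_mon_inj[/= <- <-]]]; [by constructor 1|by constructor 2|].
  constructor 3; exists i => //; have [|_ _ Hc Hd] := division i; lia.
split.
- apply: ideals_ab_gen => //.
  move=> e f /Scase[[-> ->]|[-> ->]|[i ik [Ee Ef]]]; try lia.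
  by have := weight_ge a1 le_ab Dcd division kmin ik; rewrite -Ee -Ef; lia.
- apply: smallest_sub; first exact: ideal_gen_is_ideal.
  move=> _ [[]->|->]; apply: sub_gen_smallest => //.
  by rewrite -c1 -d1; apply: Su.
- apply: is_red_ab_1_gen => //.
    have := Su 1%N k1; rewrite c1 d1 => S1; exists `|c|%N, `|d|%N; split=> //.
      by lia.
    by lia.
  set JL := ideal_mul _ _.
  have IJL : is_ideal JL by apply: ideal_gen_is_ideal.
  have JLa e f e' f' : S (xy_mon K e f) -> (a + e <= e')%N -> (f <= f')%N -> JL (xy_mon K e' f').
    move=> Sef ae ff; apply: ideal_xy_mon_le IJL _ ae ff.
    rewrite -(add0n f) -xy_monM /JL ideal_mul_gen; apply: sub_gen_smallest.
    by exists (xy_mon K a 0); [left|exists (xy_mon K e f)].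
  have JLb e f e' f' : S (xy_mon K e f) -> (e <= e')%N -> (b + f <= f')%N -> JL (xy_mon K e' f').
    move=> Sef ee bf; apply: ideal_xy_mon_le IJL _ ee bf.
    rewrite -(add0n e) -xy_monM /JL ideal_mul_gen; apply: sub_gen_smallest.
    by exists (xy_mon K 0 b); [right|exists (xy_mon K e f)].
  move=> e f e' f' Sef Sef'.
  case: (Scase _ _ Sef) => [[Ee Ef]|[Ee Ef]|[i ik [Ee Ef]]].
  + by apply: JLa Sef' _ _; lia.
  + by apply: JLb Sef' _ _; lia.
  case: (Scase _ _ Sef') => [[Ee' Ef']|[Ee' Ef']|[j jk [Ee' Ef']]].
  + by apply: JLa Sef _ _; lia.
  + by apply: JLb Sef _ _; lia.
  case: (residue_sum a1 le_ab Dcd division kmin ik jk) => [[le1 le2]|[t tk]].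
    by apply: JLa Sb _ _; lia.
  have [|_ _ Hct Hdt] := division t; first by case/andP: tk.
  by case=> -[le1 le2]; [apply: JLa (Su t tk) _ _|apply: JLb (Su t tk) _ _]; rewrite /=; lia.
move=> _ [[G GM ->] _] IL' [red _].
rewrite /L -/S; apply: smallest_sub; first exact: ideal_gen_is_ideal.
have GI := ideal_gen_is_ideal G.
have Lp : ideal_gen G (xy_mon K `|c| `|d|) by apply: IL'; apply: sub_gen_smallest; right.
have square i : ideal_gen G (u_mon K (ci i, di i)) ->
    exists e f, G (xy_mon K e f) /\
      ((a + e <= `|ci i| + `|c|)%N /\ (f <= `|di i| + `|d|)%N \/
       (e <= `|ci i| + `|c|)%N /\ (b + f <= `|di i| + `|d|)%N).
  move=> Gi; apply: monomial_J_mul_gen => //; move: red.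
  rewrite [ideal_pow _ 2](_ : _ = ideal_mul (ideal_gen G) (ideal_pow (ideal_gen G) 1)) //.
  rewrite [ideal_pow _ 1]ideal_mulT // => <-; rewrite -xy_monM.
  by apply: sub_gen_smallest; exists (u_mon K (ci i, di i)), (xy_mon K `|c| `|d|).
move=> _ [[->|->]|[i ik <-]].
- by apply: IL'; apply: sub_gen_smallest; left; left.
- by apply: IL'; apply: sub_gen_smallest; left; right.
(* Here square divides u_(p_i) u_p by x^a or y^b times a generator; residue_succ
   tells which coordinate can pay for that power. *)
case/andP: ik; elim: i => // i IH _ ik.
have [->|i_ne0] := eqVneq i 0%N; first by rewrite c1 d1.
have i1 : (1 <= i)%N by rewrite lt0n.
have [e [f [Gef le]]] := square i (IH i1 (ltnW ik)).
have [_ _ Hci Hdi] := division _ i1; have [_ _ Hcs Hds] := division _ (ltn0Sn i).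
apply: (ideal_xy_mon_le GI (sub_gen_smallest Gef)) => /=.
  by have := residue_succ a1 le_ab Dcd division kmin i1 ik; lia.
by have := residue_succ a1 le_ab Dcd division kmin i1 ik; lia.
Qed.
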